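(* For all integers $k \ge 2$ and $v \ge 1$, $\check\mu(k,v) \le (v+1)^k - 1$. Moreover, for $k \ge 2$: $\check\mu(k,v) \ge (v+1)^{k-1}/2$ when $v = 1$; $\check\mu(k,v) \ge 2(v+1)^{k-1}/3$ when $v = 2$; and $\check\mu(k,v) \ge (v-2)(v+1)^{k-1}$ when $v \ge 3$.
   Context: All graphs are finite and simple. An interval graph is the intersection graph of a finite family of open intervals of the real line. The claw number of a graph $G$ is the largest integer $v \ge 0$ such that the star $K_{1,v}$ is an induced subgraph of $G$. For $k \ge 1$ and $v \ge 1$, $\check\mu(k,v)$ denotes the largest integer $w$ such that every interval graph with claw number at most $w$ admits a partition of its vertex set into $k$ subsets each inducing a subgraph with claw number at most $v$. *)

(* Defs.v *)
From mathcomp Require Import all_boot all_order all_algebra.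
From mathcomp Require Import reals.

Set Implicit Arguments.
Unset Strict Implicit.
Unset Printing Implicit Defensive.

Import Order.TTheory GRing.Theory Num.Theory.

Record sgraph := SGraph {
  vertex :> finType;
  edge : rel vertex;
  edge_sym : symmetric edge;
  edge_irrefl : irreflexive edge }.

Section Induced.
Variables (G : sgraph) (A : {set G}).

Definition induced_edge : rel {x : G | x \in A} :=
  fun x y => edge (val x) (val y).

Fact induced_sym : symmetric induced_edge.
Proof. by move=> x y; apply: edge_sym. Qed.

Fact induced_irrefl : irreflexive induced_edge.
Proof. by move=> x; apply: edge_irrefl. Qed.

Definition induced : sgraph := SGraph induced_sym induced_irrefl.

End Induced.

Section Star.
Variable v : nat.

(* The centre of K_{1,v} is None, its leaves are the Some i. *)
Definition star_edge : rel (option 'I_v) := fun x y => isSome x != isSome y.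

Fact star_sym : symmetric star_edge.
Proof. by move=> x y; rewrite /star_edge eq_sym. Qed.

Fact star_irrefl : irreflexive star_edge.
Proof. by move=> x; rewrite /star_edge eqxx. Qed.

Definition star : sgraph := SGraph star_sym star_irrefl.

End Star.

(* H is isomorphic to an induced subgraph of G. *)
Definition induced_sub (H G : sgraph) : bool :=
  [exists f : {ffun H -> G},
    injectiveb f && [forall x, forall y, edge (f x) (f y) == edge x y]].

(* An induced K_{1,v} has v + 1 vertices, so v ranges over v < #|G|. For the
   graph without vertices, which has no induced star at all, the value is 0. *)
Definition claw_number (G : sgraph) : nat :=
  \max_(v < #|G| | induced_sub (star v) G) v.

Lemma card_star_sub (v : nat) (G : sgraph) : induced_sub (star v) G -> v < #|G|.
Proof.
case/existsP=> f /andP[/injectiveP f_inj _].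
by have := leq_card f f_inj; rewrite card_option card_ord.
Qed.

Lemma claw_number_max (v : nat) (G : sgraph) :
  induced_sub (star v) G -> v <= claw_number G.
Proof.
move=> Gv; have v_lt := card_star_sub Gv.
exact: (@leq_bigmax_cond _ _ (fun i : 'I_#|G| => i : nat) (Ordinal v_lt)).
Qed.

Lemma claw_number_attained (G : sgraph) :
  0 < #|G| -> induced_sub (star (claw_number G)) G.
Proof.
move=> G_gt0; have /card_gt0P[c _] := G_gt0.
have star0 : induced_sub (star 0) G.
  apply/existsP; exists [ffun=> c]; apply/andP; split.
    by apply/injectiveP=> -[[]|] // -[[]|].
  apply/forallP=> -[[]|] //; apply/forallP=> -[[]|] //.
  by rewrite !ffunE edge_irrefl.
pose A := [pred i : 'I_#|G| | induced_sub (star i) G].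
have A_gt0 : 0 < #|A| by apply/card_gt0P; exists (Ordinal G_gt0).
have [v Gv def_v] := eq_bigmax_cond (fun i : 'I_#|G| => i : nat) A_gt0.
by rewrite (_ : claw_number G = v).
Qed.

Definition interval_graph (R : realType) (G : sgraph) : Prop :=
  exists a b : G -> R,
    (forall x, (a x < b x)%R) /\
    (forall x y, edge x y <->
       x <> y /\ exists z : R, z \in `]a x, b x[%R /\ z \in `]a y, b y[%R).

(* The k parts may be empty. *)
Definition is_partition (T : finType) (k : nat) (P : 'I_k -> {set T}) : Prop :=
  forall x, exists! i, x \in P i.

Definition claw_partitionable (k v : nat) (G : sgraph) : Prop :=
  exists P : 'I_k -> {set G},
    is_partition P /\ forall i, claw_number (induced (P i)) <= v.

Definition mu_admissible (R : realType) (k v w : nat) : Prop :=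
  forall G : sgraph,
    interval_graph R G -> claw_number G <= w -> claw_partitionable k v G.

Definition is_mu (R : realType) (k v w : nat) : Prop :=
  mu_admissible R k v w /\ forall w', mu_admissible R k v w' -> w' <= w.

(* Main.v *)
(* Lower bounds: take disjoint intervals greedily by increasing right endpoint;
   their right endpoints are points of the line such that every interval contains
   at least one and at most w of them, w being the claw number. Number these
   points and fix a top level t. Give an interval the largest level j <= t such
   that it contains a point whose number is a multiple of (v+1)^j. For j < t the
   intervals of level j lie in disjoint cells, each with v such points, so the
   level has claw number at most v. If w <= (v-2)(v+1)^t, an interval of level t
   contains at most v - 2 multiples of (v+1)^t and its neighbours of level t reach
   at most two more, so one colour suffices for level t; if w <= v(v+1)^t two
   colours do, alternating between blocks of v consecutive multiples of (v+1)^t.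
   Upper bound: consider the complete (v+1)-ary tree of nested intervals of depth
   k. As the colour of the root cannot occur below each of its v+1 children, some
   child avoids it; descending, the k colours run out before the leaves. *)

Require Import Defs.
From mathcomp Require Import all_boot all_order all_algebra.
From mathcomp Require Import reals.
From mathcomp Require Import boolp zify.

Set Implicit Arguments.
Unset Strict Implicit.
Unset Printing Implicit Defensive.

Import Order.TTheory GRing.Theory Num.Theory.

(** * Induced stars, claw numbers and open intervals *)

Lemma star_subP (m : nat) (G : sgraph) :
  reflect (exists (x : G) (g : 'I_m -> G),
             [/\ injective g, forall i, edge x (g i)
               & forall i j, ~~ edge (g i) (g j)])
          (induced_sub (star m) G).
Proof.
apply: (iffP existsP) => [[f /andP[/injectiveP f_inj /forallP fE]]|].
  have {}fE y z : edge (f y) (f z) = edge y z by apply/eqP/(forallP (fE y)).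
  exists (f None), (fun i => f (Some i)); split=> [i j /f_inj[] //|i|i j].
    by rewrite fE.
  by rewrite fE.
move=> [x [g [g_inj xg gg]]].
exists [ffun o => if o is Some i then g i else x]; apply/andP; split.
  apply/injectiveP=> -[i|] [j|]; rewrite !ffunE //.
  - by move/g_inj->.
  - by move=> gi; have := xg i; rewrite gi edge_irrefl.
  - by move=> gi; have := xg j; rewrite gi edge_irrefl.
apply/forallP=> -[i|]; apply/forallP=> -[j|]; rewrite !ffunE.
- by rewrite (negPf (gg i j)).
- by rewrite edge_sym xg.
- by rewrite xg.
- by rewrite edge_irrefl.
Qed.

Lemma claw_number_geq (G : sgraph) (m : nat) (x : G) (g : 'I_m -> G) :
  injective g -> (forall i, edge x (g i)) -> (forall i j, ~~ edge (g i) (g j)) ->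
  m <= claw_number G.
Proof.
by move=> g_inj xg gg; apply/claw_number_max/star_subP; exists x, g.
Qed.

Lemma claw_number_leq (G : sgraph) (v : nat) :
  (forall m (x : G) (g : 'I_m -> G), injective g -> (forall i, edge x (g i)) ->
     (forall i j, ~~ edge (g i) (g j)) -> m <= v) ->
  claw_number G <= v.
Proof.
move=> le_v; apply/bigmax_leqP=> m /star_subP[x [g [g_inj xg gg]]].
exact: le_v gg.
Qed.

Lemma card_indep_neighbours (G : sgraph) (x : G) (S : {set G}) :
  {in S, forall y, edge x y} -> {in S &, forall y z, ~~ edge y z} ->
  #|S| <= claw_number G.
Proof.
move=> xS SS; apply: (@claw_number_geq _ _ x enum_val).
- exact: enum_val_inj.
- by move=> i; apply/xS/enum_valP.
- by move=> i j; apply: SS; apply: enum_valP.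
Qed.

Lemma partition_preim (T : finType) (k : nat) (c : T -> 'I_k) :
  is_partition (fun i => [set x | c x == i]).
Proof.
move=> x; exists (c x); split=> [|i]; rewrite inE //; exact/eqP.
Qed.

Lemma open_itv_meet (R : realType) (a b c d : R) : (a < b)%R -> (c < d)%R ->
  (exists z, z \in `]a, b[%R /\ z \in `]c, d[%R) <-> (a < d)%R /\ (c < b)%R.
Proof.
move=> ab cd; split=> [[z []]|[ad cb]].
  rewrite !in_itv /= => /andP[az zb] /andP[cz zd].
  by split; [apply: lt_trans zd | apply: lt_trans zb].
have lt_m : (Num.max a c < Num.min b d)%R.
  by rewrite gt_max !lt_min ab ad cb cd.
have [] := midf_lt lt_m; rewrite gt_max lt_min.
move=> /andP[az cz] /andP[zb zd].
by exists ((Num.max a c + Num.min b d) / 2)%R; rewrite !in_itv /= az zb cz zd.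
Qed.

(** * Lower bounds *)

(* Abstracts an interval representation together with a finite increasing
   sequence of points of the line: the interval of x contains exactly the points
   with indices l x, ..., r x, so between 1 and w of them. *)
Definition ruler (G : sgraph) (w : nat) (l r : G -> nat) : Prop :=
  [/\ forall x, l x <= r x < l x + w,
      forall x y, x != y -> ~~ edge x y -> r x < l y \/ r y < l x
    & forall x y, edge x y -> l y <= (r x).+1].

(* Greedy choice of pairwise disjoint intervals by increasing right endpoint. *)
Lemma disjoint_piercing (R : realType) (T : finType) (a b : T -> R) (A : {set T}) :
  (forall x, a x < b x)%R ->
  exists S : {set T}, [/\ S \subset A,
    {in S &, forall y z, y != z -> ~~ ((a y < b z) && (a z < b y))%R}
    & forall x, x \in A -> exists2 z, z \in S & (a x < b z <= b x)%R].
Proof.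
move=> ab; have [n] := ubnP #|A|; elim: n A => // n IHn A.
rewrite ltnS => leAn.
have [->|[z0 Az0]] := set_0Vmem A.
  by exists set0; split=> [|y z|x]; rewrite ?sub0set ?inE.
have [z Az z_min] := @arg_minP _ _ _ z0 [in A] b Az0.
have {}Az : z \in A := Az.
pose A' := [set x in A | (b z <= a x)%R].
have sA'A : A' \subset A by apply/subsetP=> x; rewrite inE => /andP[].
have [|S [sSA' disjS pS]] := IHn A'.
  apply: leq_trans leAn; apply/proper_card/properP; split=> //.
  by exists z => //; rewrite inE Az /= -ltNge.
have S_right y : y \in S -> (b z <= a y)%R.
  by move/(subsetP sSA'); rewrite inE => /andP[].
exists (z |: S); split.
- by rewrite subUset sub1set Az (subset_trans sSA').
- move=> x y; rewrite !inE => /predU1P[->|Sx] /predU1P[->|Sy].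
  + by rewrite eqxx.
  + by move=> _; rewrite andbC ltNge S_right.
  + by move=> _; rewrite ltNge S_right.
  + exact: disjS.
- move=> x Ax; have [azx|xz] := leP (b z) (a x).
    have [|y Sy xy] := pS x; first by rewrite inE Ax.
    by exists y; rewrite // inE Sy orbT.
  by exists z; rewrite ?setU11 // xz z_min.
Qed.

(** The points are the right endpoints of the chosen disjoint intervals; [c t] counts those up to
    [t]. Chosen intervals other than [x] that end within [x] are independent neighbours of [x],
    hence at most [w] many. *)
Lemma interval_graph_ruler (R : realType) (G : sgraph) (w : nat) :
  0 < w -> interval_graph R G -> claw_number G <= w ->
  exists l r : G -> nat, ruler w l r.
Proof.
move=> w_gt0 [a [b [ab edgeE]]] clawG.
have {}edgeE x y : edge x y = [&& x != y, (a x < b y)%R & (a y < b x)%R].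
  apply/idP/and3P=> [/edgeE[/eqP xy]|[/eqP xy xy1 xy2]].
    by case/open_itv_meet.
  by apply/edgeE; split=> //; apply/open_itv_meet.
have [S [_ disjS pS]] := disjoint_piercing [set: G] ab.
pose c t := #|[set z in S | (b z <= t)%R]|.
have c_mono t u : (t <= u)%R -> c t <= c u.
  move=> tu; apply/subset_leq_card/subsetP=> z; rewrite !inE => /andP[-> /=].
  by move/le_trans->.
have cD x : c (b x) = c (a x) + #|[set z in S | (a x < b z <= b x)%R]|.
  rewrite /c -(cardsID [set z | (b z <= a x)%R]); congr (_ + _); apply: eq_card.
    move=> z; rewrite !inE; case: (z \in S) => //=.
    by have [zx|] := leP (b z) (a x); rewrite ?andbF // (le_trans zx (ltW (ab x))).
  by move=> z; rewrite !inE -ltNge; case: (z \in S); rewrite ?andbF.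
exists (fun x => (c (a x)).+1), (fun x => c (b x)); split=> [x|x y|x y].
- rewrite cD addSn ltnS -addn1 !leq_add2l; apply/andP; split.
    have [z Sz zx] := pS x (in_setT x).
    by apply/card_gt0P; exists z; rewrite inE Sz.
  (* A chosen [x] is not its own neighbour, but its own endpoint is then the only one it contains,
     so [0 < w] suffices. *)
  have [Sx|S'x] := boolP (x \in S).
    apply: leq_trans w_gt0; rewrite -(cards1 x); apply/subset_leq_card/subsetP=> z.
    rewrite !inE => /and3P[Sz xz zx]; apply/idPn=> z'x.
    by have := disjS z x Sz Sx z'x; rewrite xz (lt_le_trans (ab z)).
  apply: leq_trans clawG; apply: (@card_indep_neighbours _ x).
    move=> z; rewrite inE => /and3P[Sz xz zx].
    rewrite edgeE xz (lt_le_trans (ab z)) //= andbT.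
    by apply: contraNneq S'x => ->.
  move=> y z; rewrite !inE => /and3P[Sy _ _] /and3P[Sz _ _]; rewrite edgeE.
  by have [//|yz] := eqVneq y z; apply: disjS.
- move=> xy; rewrite edgeE xy /= negb_and -!leNgt => /orP[] ?; [right|left];
  by rewrite ltnS c_mono.
- by rewrite edgeE ltnS => /and3P[_ _ /ltW]; apply: c_mono.
Qed.

Section RulerLevels.
Variables (G : sgraph) (w : nat) (l r : G -> nat).
Hypothesis lr : ruler w l r.

(** Nonadjacent vertices have disjoint index ranges, so picking a multiple of [L] in each leaf
    injects the leaves into [v] consecutive multipliers. *)
Lemma ruler_claw (A : {set G}) (v L : nat) :
  {in A, forall x, exists s, {in A, forall y, edge x y ->
     exists2 q, s <= q < s + v & l y <= q * L <= r y}} ->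
  claw_number (induced A) <= v.
Proof.
have [_ disj _] := lr; move=> AP; apply: claw_number_leq => m x g g_inj xg gg.
have [s sP] := AP _ (valP x).
have [|q qs qr] := @fin_all_exists2 _ (fun=> nat)
  (fun i q => s <= q < s + v) (fun i q => l (val (g i)) <= q * L <= r (val (g i))).
  by move=> i; apply: sP (valP (g i)) (xg i).
have ltq i : q i - s < v by have := qs i; lia.
rewrite -[m]card_ord -[v]card_ord.
apply: (@leq_card _ _ (fun i => Ordinal (ltq i))) => i j /(congr1 val) /= eq_q.
have {eq_q}eq_q : q i = q j by have := qs i; have := qs j; lia.
apply/g_inj/val_inj/eqP/idPn=> neq_g.
have [] := disj _ _ neq_g (gg i j); have := qr i; have := qr j; rewrite eq_q; lia.
Qed.

Definition meets_multiple (L : nat) (x : G) : bool := l x <= r x %/ L * L.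

(** Multiples of [D ^ j.+1] are multiples of [D ^ j], so the first failure marks the largest power
    met; without failure [find] returns the cap [n]. *)
Definition level (D n : nat) (x : G) : nat :=
  find (fun j => ~~ meets_multiple (D ^ j.+1) x) (iota 0 n).

Lemma level_leq D n x : level D n x <= n.
Proof. by rewrite -[leqRHS](size_iota 0) find_size. Qed.

Lemma meets_level D n x : meets_multiple (D ^ level D n x) x.
Proof.
have [lr0 _ _] := lr; case def_j: (level D n x) => [|j].
  by rewrite /meets_multiple expn0 divn1 muln1; case/andP: (lr0 x).
have ltj : j < find (fun j => ~~ meets_multiple (D ^ j.+1) x) (iota 0 n).
  by rewrite -/(level D n x) def_j.
have := before_find 0 ltj; rewrite nth_iota ?add0n => [/negbFE //|].
by apply: leq_trans ltj _; apply: level_leq.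
Qed.

Lemma meets_levelS D n x :
  level D n x < n -> ~~ meets_multiple (D ^ (level D n x).+1) x.
Proof.
move=> ltn; have hasP : has (fun j => ~~ meets_multiple (D ^ j.+1) x) (iota 0 n).
  by rewrite has_find size_iota.
by have := nth_find 0 hasP; rewrite -/(level D n x) nth_iota ?add0n.
Qed.

Lemma multiple_bounds L x : 0 < L -> r x %/ L * L <= r x < (r x %/ L).+1 * L.
Proof. by move=> L0; rewrite leq_trunc_div ltn_ceil. Qed.

(* Members of a level that are adjacent lie in the same cell between consecutive
   multiples of D ^ j.+1, and this cell contains D - 1 multiples of D ^ j. *)
Lemma claw_low_level (v j : nat) (A : {set G}) :
  {in A, forall x, meets_multiple (v.+1 ^ j) x &&
                   ~~ meets_multiple (v.+1 ^ j.+1) x} ->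
  claw_number (induced A) <= v.
Proof.
have [_ _ adj] := lr; move=> AP; apply: (@ruler_claw _ _ (v.+1 ^ j)) => x Ax.
exists (r x %/ v.+1 ^ j.+1 * v.+1).+1 => y Ay xy.
have /andP[_ Mx] := AP _ Ax; have /andP[my My] := AP _ Ay.
have lyx := adj _ _ xy; have lxy : l x <= (r y).+1 by apply: adj; rewrite edge_sym.
have L0 : 0 < v.+1 ^ j by rewrite expn_gt0.
have M0 : 0 < v.+1 ^ j.+1 by rewrite expn_gt0.
have bx := multiple_bounds x M0; have bY := multiple_bounds y M0.
have by_ := multiple_bounds y L0.
move: Mx My my; rewrite /meets_multiple -!ltnNge => Mx My my.
(* A multiple of [v.+1 ^ j.+1] between the two right ends would lie inside one interval, since
   adjacency leaves no index between them. *)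
have eq_c : r x %/ v.+1 ^ j.+1 = r y %/ v.+1 ^ j.+1.
  apply/eqP; rewrite eqn_leq -[X in X && _]ltnS -[X in _ && X]ltnS.
  rewrite -[X in X && _](ltn_pmul2r M0) -[X in _ && X](ltn_pmul2r M0).
  rewrite (leq_trans (leq_trans Mx lxy)) ?(leq_trans (leq_trans My lyx)) //.
    by case/andP: bx.
  by case/andP: bY.
exists (r y %/ v.+1 ^ j); last by rewrite my; case/andP: by_.
have E c : c * v.+1 * v.+1 ^ j = c * v.+1 ^ j.+1 by rewrite expnS mulnA.
rewrite addSn -addnS -mulSnr eq_c.
rewrite -[X in X && _](ltn_pmul2r L0) -[X in _ && X](ltn_pmul2r L0) !E.
rewrite (leq_trans My my) (leq_ltn_trans _ (proj2 (andP bY))) //.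
by case/andP: by_.
Qed.

End RulerLevels.

Lemma mu_admissible_one_top (R : realType) (n v : nat) : 3 <= v ->
  mu_admissible R n.+1 v ((v - 2) * v.+1 ^ n).
Proof.
move=> v3 G intG clawG; have L0 : 0 < v.+1 ^ n by rewrite expn_gt0.
have [|l [r lr]] := interval_graph_ruler _ intG clawG.
  by rewrite muln_gt0 L0; lia.
have [w_lr _ adj] := lr.
exists (fun i => [set x | inord (level l r v.+1 n x) == i :> 'I_n.+1]).
split=> [|i]; first exact: (partition_preim (fun x => inord (level l r v.+1 n x))).
have lev x : x \in [set x | inord (level l r v.+1 n x) == i] ->
    level l r v.+1 n x = i.
  by rewrite inE => /eqP<-; rewrite inordK // ltnS level_leq.
have [ltin|] := ltnP i n.
  apply: (@claw_low_level _ _ _ _ lr v i) => x /lev lev_x.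
  by rewrite -lev_x (meets_level lr) meets_levelS // lev_x.
move=> le_ni; have def_i : i = n :> nat by have := ltn_ord i; lia.
apply: (ruler_claw lr (L := v.+1 ^ n)) => x /lev lev_x.
(* With [q] the last multiplier up to [r x], the window is [q - (v - 2)] to [q + 1]: at most [v - 2]
   multiples in [x] and one more on each side. *)
exists (r x %/ v.+1 ^ n + 2 - v) => y /lev lev_y xy.
have := meets_level lr v.+1 n y; rewrite lev_y def_i /meets_multiple => my.
have lyx := adj _ _ xy; have lxy : l x <= (r y).+1 by apply: adj; rewrite edge_sym.
have bx := multiple_bounds r x L0; have by_ := multiple_bounds r y L0.
have wx := w_lr x.
set q := r x %/ _ in bx *; set q' := r y %/ _ in by_ my *.
have lt_q : q < q'.+1 + (v - 2) by rewrite -(ltn_pmul2r L0) mulnDl; lia.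
(* A long [y] may run past [q.+1]; it then contains that multiple too, as it starts by
   [(r x).+1]. *)
exists (minn q' q.+1); first lia.
by case: (leqP q' q.+1) => lt_q'; [lia|have := leq_mul lt_q' (leqnn (v.+1 ^ n)); lia].
Qed.

Lemma mu_admissible_two_tops (R : realType) (n v : nat) : 1 <= v ->
  mu_admissible R n.+2 v (v * v.+1 ^ n).
Proof.
move=> v1 G intG clawG; have L0 : 0 < v.+1 ^ n by rewrite expn_gt0.
have [|l [r lr]] := interval_graph_ruler _ intG clawG.
  by rewrite muln_gt0 L0; lia.
have [w_lr _ adj] := lr.
pose block x := r x %/ v.+1 ^ n %/ v.
pose lev x := level l r v.+1 n x.
pose col x := if lev x < n then lev x else n + odd (block x).
have col_lt x : col x < n.+2.
  by rewrite /col; case: ifP => [|_]; [lia | case: odd; lia].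
exists (fun i => [set x | Ordinal (col_lt x) == i]).
split=> [|i]; first exact: (partition_preim (fun x => Ordinal (col_lt x))).
have colE x : x \in [set x | Ordinal (col_lt x) == i] -> col x = i.
  by rewrite inE => /eqP<-.
have [ltin|le_ni] := ltnP i n.
  apply: (@claw_low_level _ _ _ _ lr v i) => x /colE; rewrite /col.
  case: ifP => [lt_x <-|_ ?]; last lia.
  by rewrite (meets_level lr) meets_levelS.
have topP x : x \in [set x | Ordinal (col_lt x) == i] ->
    odd (block x) = (i != n :> nat) /\ meets_multiple l r (v.+1 ^ n) x.
  move=> /colE; rewrite /col; case: ltnP => [|le_nx def_i]; first lia.
  split; first by rewrite -def_i; case: odd; lia.
  have := meets_level lr v.+1 n x.
  by rewrite (_ : level _ _ _ _ _ = n) //; apply/eqP; rewrite eqn_leq level_leq.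
(* So the blocks of adjacent intervals of the same colour coincide, by parity. *)
have near x y : edge x y -> block y <= (block x).+1.
  move=> xy; rewrite -ltnS ltn_divLR //.
  have lyx := adj _ _ xy; have wy := w_lr y.
  have bx := multiple_bounds r x L0; have by_ := multiple_bounds r y L0.
  have bb : r x %/ v.+1 ^ n < (block x).+1 * v by apply: ltn_ceil.
  (* As [y] starts by [(r x).+1] and has at most [v * v.+1 ^ n] indices, the multiplier grows by at
     most [v], that is, by one block. *)
  suff : r y %/ v.+1 ^ n < (r x %/ v.+1 ^ n).+1 + v by lia.
  by rewrite -(ltn_pmul2r L0) mulnDl; lia.
apply: (ruler_claw lr (L := v.+1 ^ n)) => x /topP[odd_x _].
exists (block x * v) => y /topP[odd_y my] xy.
have eq_b : block y = block x.
  have := near _ _ xy; have := near y x; rewrite edge_sym => /(_ xy).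
  by have := odd_x; rewrite -odd_y; lia.
exists (r y %/ v.+1 ^ n); last by rewrite [_ <= _]my leq_trunc_div.
by rewrite -eq_b leq_trunc_div addnC -mulSn ltn_ceil.
Qed.

(** * Upper bound *)

Section Tree.
Variables k v : nat.
Local Notation D := v.+1.

(* The node (i, p) stands for the interval of length D ^ i between consecutive
   multiples of D ^ i that contains p + 1/2. Every such interval occurs D ^ i
   times, which is harmless. *)
Definition tree_vertex : finType := ('I_k.+1 * 'I_(D ^ k))%type.

Definition same_cell (i p q : nat) : bool := p %/ D ^ i == q %/ D ^ i.

(** Cells are nested or disjoint, so two of them meet exactly when their positions share a cell of
    the larger level. *)
Definition tree_edge : rel tree_vertex := fun x y =>
  (x != y) && same_cell (maxn x.1 y.1) x.2 y.2.

Fact tree_edge_sym : symmetric tree_edge.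
Proof. by move=> x y; rewrite /tree_edge eq_sym maxnC /same_cell [X in _ && X]eq_sym. Qed.

Fact tree_edge_irrefl : irreflexive tree_edge.
Proof. by move=> x; rewrite /tree_edge eqxx. Qed.

Definition tree : sgraph := SGraph tree_edge_sym tree_edge_irrefl.

Definition cell_start (i p : nat) : nat := p %/ D ^ i * D ^ i.
Definition cell_end (i p : nat) : nat := (p %/ D ^ i).+1 * D ^ i.

Lemma cells_meet (i j p q : nat) :
  same_cell (maxn i j) p q =
  (cell_start i p < cell_end j q) && (cell_start j q < cell_end i p).
Proof.
wlog le_ij : i j p q / i <= j.
  move=> W; have [/W-> //|le_ji] := orP (leq_total i j).
  by rewrite maxnC /same_cell eq_sym -/(same_cell _ q p) W // andbC.
rewrite (maxn_idPr le_ij) /same_cell /cell_start /cell_end.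
rewrite -(subnK le_ij) expnD mulnC divnMA [_ ^ i * _]mulnC !mulnA.
set N := _ ^ (j - i); set c := q %/ _; set u := p %/ _.
have L0 : 0 < D ^ i by rewrite expn_gt0.
have N0 : 0 < N by rewrite expn_gt0.
by rewrite !ltn_pmul2r // ltnS eqn_leq -[X in X && _]ltnS ltn_divLR // leq_divRL.
Qed.

Lemma tree_interval_graph (R : realType) : interval_graph R tree.
Proof.
exists (fun x : tree => (cell_start x.1 x.2)%:R%R),
  (fun x : tree => (cell_end x.1 x.2)%:R%R).
have lt_cell (i p : nat) : cell_start i p < cell_end i p.
  by rewrite ltn_pmul2r // expn_gt0.
split=> [x|x y]; first by rewrite ltr_nat.
rewrite open_itv_meet ?ltr_nat //= /tree_edge cells_meet.
by split=> [/and3P[/eqP]|[/eqP xy [-> ->]]] //; rewrite xy.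
Qed.

(** Nodes with equal position form a clique, so the leaves of a star have distinct positions. *)
Lemma tree_claw_number : claw_number tree <= D ^ k.
Proof.
apply: claw_number_leq => m x g g_inj _ gg.
rewrite -[m]card_ord -[D ^ k]card_ord.
apply: (@leq_card _ _ (fun i => (g i).2)) => i j eq_ij; apply: g_inj.
by have := gg i j; rewrite /edge /= /tree_edge eq_ij /same_cell eqxx andbT negbK => /eqP.
Qed.

(* If every child cell of the node (j, p) contained a node with the colour of
   (j, p), these nodes would be the leaves of a monochromatic claw. *)
Lemma tree_colours (P : 'I_k -> {set tree}) (j : nat) (p : 'I_(D ^ k))
    (C : {set 'I_k}) :
  is_partition P -> (forall i, claw_number (induced (P i)) <= v) -> j <= k ->
  (forall (x : tree) i, x.1 <= j -> same_cell j x.2 p -> x \in P i -> i \in C) ->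
  j < #|C|.
Proof.
move=> partP clawP; elim: j p C => [|j IHj] p C lejk CP.
  have [c [Pc _]] := partP (ord0, p).
  by apply/card_gt0P; exists c; apply: CP Pc; rewrite // /same_cell eqxx.
pose z : tree := (inord j.+1, p).
have z1 : z.1 = j.+1 :> nat by rewrite inordK // ltnS.
have [c [Pc _]] := partP z.
have Cc : c \in C by apply: CP Pc; rewrite ?z1 // /same_cell eqxx.
(* The left end of the [t]-th child cell is a valid position: the cell of [p] ends by [D ^ k], a
   multiple of [D ^ j.+1]. *)
have ltp (t : 'I_D) : (p %/ D ^ j.+1 * D + t) * D ^ j < D ^ k.
  rewrite (leq_trans (n := (p %/ D ^ j.+1).+1 * D ^ j.+1)) //.
    set c' := p %/ _.
    by rewrite expnS mulnA ltn_pmul2r ?expn_gt0 // mulSnr ltn_add2l.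
  rewrite -[leqRHS](divnK (dvdn_exp2l D lejk)) leq_pmul2r ?expn_gt0 //.
  by rewrite ltn_divLR ?expn_gt0 // divnK ?dvdn_exp2l.
pose pt t : 'I_(D ^ k) := Ordinal (ltp t).
have cell_pt t q : same_cell j q (pt t) -> q %/ D ^ j = p %/ D ^ j.+1 * D + t.
  by move=> /eqP->; rewrite mulnK // expn_gt0.
have cell_up t q : same_cell j q (pt t) -> same_cell j.+1 q p.
  move=> /cell_pt q_t; rewrite /same_cell {1}expnSr divnMA q_t.
  by rewrite divnMDl // (divn_small (ltn_ord t)) addn0.
have [/existsP[t /forallP tP]|] := boolP [exists t : 'I_D, forall x : tree,
    (x.1 <= j) ==> same_cell j x.2 (pt t) ==> (x \notin P c)].
  (* Child [t] avoids the colour [c]: descend there with [c] removed from [C]. *)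
  rewrite (cardsD1 c) Cc ltnS; apply: (IHj (pt t)); first exact: ltnW.
  move=> x i xj xt xi; rewrite !inE; apply/andP; split.
    by apply: contraL xi => /eqP->; have := tP x; rewrite xj xt.
  by apply: CP xi; [apply: leqW | apply: cell_up xt].
rewrite negb_exists => /forallP noP.
have [|g gc gP] := @fin_all_exists2 _ (fun=> tree) (fun t x => x \in P c)
    (fun t x => (x.1 <= j) && same_cell j x.2 (pt t)).
  move=> t; have := noP t; rewrite negb_forall => /existsP[x].
  rewrite 2!negb_imply negbK => /and3P[xj xt xc].
  by exists x; last apply/andP.
have := clawP c; rewrite leqNgt => /negP[].
(* Sharing a cell of level at most [j] forces the same child cell. *)
have g_sep t u : same_cell (maxn (g t).1 (g u).1) (g t).2 (g u).2 -> t = u.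
  have /andP[tj tc] := gP t; have /andP[uj uc] := gP u => tu.
  apply/val_inj/eqP; rewrite -(eqn_add2l (p %/ D ^ j.+1 * D)).
  rewrite -(cell_pt _ _ tc) -(cell_pt _ _ uc).
  have le_m : maxn (g t).1 (g u).1 <= j by rewrite geq_max tj.
  by rewrite -(subnKC le_m) expnD !divnMA (eqP tu).
apply: (@claw_number_geq (induced (P c)) _ (exist _ z Pc)
                         (fun t => exist _ (g t) (gc t))).
- by move=> t u /(congr1 val) /= eq_g; apply: g_sep; rewrite eq_g /same_cell.
- move=> t; have /andP[tj tc] := gP t.
  rewrite /edge /= /induced_edge /= /edge /= /tree_edge; apply/andP; split.
    by apply/eqP=> eq_z; move: tj; rewrite -eq_z z1 ltnn.
  rewrite z1 (maxn_idPl (leqW tj)) /same_cell eq_sym.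
  exact: cell_up tc.
- move=> t u; rewrite /edge /= /induced_edge /= /edge /= /tree_edge.
  by apply/negP=> /andP[neq_tu /g_sep eq_tu]; rewrite eq_tu eqxx in neq_tu.
Qed.

Lemma tree_not_partitionable : ~ claw_partitionable k v tree.
Proof.
move=> [P [partP clawP]].
have D0 : 0 < D ^ k by rewrite expn_gt0.
suff : k < #|[set: 'I_k]| by rewrite cardsT card_ord ltnn.
by apply: (tree_colours (p := Ordinal D0) partP clawP (leqnn k)) => x i; rewrite inE.
Qed.

End Tree.

Lemma mu_admissible_ltn (R : realType) (k v w : nat) :
  mu_admissible R k v w -> w < v.+1 ^ k.
Proof.
move=> adm; rewrite ltnNge; apply/negP=> le_w.
apply: (@tree_not_partitionable k v); apply: adm.
  exact: tree_interval_graph.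
exact: leq_trans (tree_claw_number k v) le_w.
Qed.

(** * Existence of the maximum and its bounds *)

Theorem theorem2 (R : realType) (k v : nat) (hk : 2 <= k) (hv : 1 <= v) :
  exists mu : nat,
    [/\ is_mu R k v mu,
        (mu%:R <= (v%:R + 1) ^+ k - 1 :> rat)%R,
        v = 1 -> ((v%:R + 1) ^+ (k - 1) / 2 <= mu%:R :> rat)%R,
        v = 2 -> (2 * (v%:R + 1) ^+ (k - 1) / 3 <= mu%:R :> rat)%R
      & 3 <= v -> ((v%:R - 2) * (v%:R + 1) ^+ (k - 1) <= mu%:R :> rat)%R].
Proof.
case: k hk => [|[|n]] // _; rewrite subn1 /=.
pose adm w := `[< mu_admissible R n.+2 v w >].
have ex_adm : exists w, adm w.
  by exists (v * v.+1 ^ n); apply/asboolP/mu_admissible_two_tops.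
have adm_le w : adm w -> w <= v.+1 ^ n.+2.
  by move=> /asboolP/mu_admissible_ltn/ltnW.
have [mu /asboolP mu_adm mu_max] := ex_maxnP ex_adm adm_le.
have {}mu_max w : mu_admissible R n.+2 v w -> w <= mu.
  by move=> adm_w; apply/mu_max/asboolP.
have two : v * v.+1 ^ n <= mu by apply/mu_max/mu_admissible_two_tops.
(* Multiplying by [v.+1] turns the two-colour bound into the factors 1/2 for [v = 1] and 2/3 for
   [v = 2]. *)
have low : v.+1 ^ n.+1 * v <= mu * v.+1.
  by rewrite expnSr mulnAC leq_pmul2r // mulnC.
exists mu; rewrite natr1; split=> //.
- by rewrite lerBrDr natr1 -natrX ler_nat (@mu_admissible_ltn R).
- move=> v1; move: low; rewrite v1 muln1 => low.
  by rewrite ler_pdivrMr // -natrX -natrM ler_nat.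
- move=> v2; move: low; rewrite v2 mulnC => low.
  by rewrite ler_pdivrMr // -natrX -!natrM ler_nat.
- move=> v3; rewrite -natrB; last by apply: ltnW.
  rewrite -natrX -natrM ler_nat; apply/mu_max/mu_admissible_one_top; exact: v3.
Qed.
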